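(* Let $\alpha=(r_1^{k_1},r_2^{k_2},\dots,r_m^{k_m})$ be a self-conjugate partition of $n$, where $r_1>\cdots>r_m>0$ and $k_i>0$ for $1\le i\le m$. If $\beta$ is a partition of $n$ and $\beta$ has a part $x$ such that either $$x\in[\max\{a^N_v,c^N_v\},\min\{b^N_v,d^N_v\}]\quad\text{for some } 2\le v\le \lfloor m/2\rfloor+1,$$ or $$x\in[\max\{a^E_v,c^E_v\},\min\{b^E_v,d^E_v\}]\quad\text{for some } 2\le v\le \lfloor (m+1)/2\rfloor,$$ then $\chi^\alpha(\beta)=0$.
   Context: The notation $(r_1^{k_1},\dots,r_m^{k_m})$ means that the part $r_i$ occurs $k_i$ times; self-conjugate means that the partition equals its conjugate (transpose). $\chi^\alpha(\beta)$ is the value of the irreducible complex character of $S_n$ labeled by $\alpha$ on the class of cycle type $\beta$. Here $[n_1,n_2]$ denotes the set of integers $k$ with $n_1\le k\le n_2$ (empty if $n_1>n_2$). For $2\le v\le\lfloor m/2\rfloor+1$ define $$a^N_v=\max\Bigl\{r_{v-i}+r_{v+i}-\sum_{t=1}^{v-i-1}k_t-\sum_{t=1}^{v+i-1}k_t \,\Big|\, 0\le i<v-1\Bigr\},$$ $$b^N_v=\min\Bigl\{r_{v-i-1}+r_{v+i-1}-\sum_{t=1}^{v-i-1}k_t-\sum_{t=1}^{v+i-1}k_t \,\Big|\, 0\le i<v-1\Bigr\},$$ $$c^N_v=\max\Bigl\{r_{v-i-1}+r_{v+i}-\sum_{t=1}^{v-i-2}k_t-\sum_{t=1}^{v+i-1}k_t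 \,\Big|\, 0\le i<v-1\Bigr\},$$ $$d^N_v=\min\Bigl\{r_{v-i-2}+r_{v+i-1}-\sum_{t=1}^{v-i-2}k_t-\sum_{t=1}^{v+i-1}k_t \,\Big|\, 0\le i<v-1\Bigr\}.$$ For $2\le v\le\lfloor (m+1)/2\rfloor$ define $$a^E_v=\max\Bigl\{r_{v-i}+r_{v+i}-\sum_{t=1}^{v-i-1}k_t-\sum_{t=1}^{v+i-1}k_t \,\Big|\, 0\le i\le v-1\Bigr\},$$ $$b^E_v=\min\Bigl\{r_{v-i-1}+r_{v+i-1}-\sum_{t=1}^{v-i-1}k_t-\sum_{t=1}^{v+i-1}k_t \,\Big|\, 0\le i\le v-1\Bigr\},$$ $$c^E_v=\max\Bigl\{r_{v-i}+r_{v+i+1}-\sum_{t=1}^{v-i-1}k_t-\sum_{t=1}^{v+i}k_t \,\Big|\, 0\le i\le v-1\Bigr\},$$ $$d^E_v=\min\Bigl\{r_{v-i-1}+r_{v+i}-\sum_{t=1}^{v-i-1}k_t-\sum_{t=1}^{v+i}k_t \,\Big|\, 0\le i\le v-1\Bigr\}.$$ Conventions: any whole expression inside the braces that contains $r_0$ (or $k_{m+1}$) is set equal to $n$; $r_{m+1}=0$; empty sums are $0$. *)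

(* Defs.v *)
From HB Require Import structures.
From mathcomp Require Import all_boot all_order all_algebra all_fingroup.
From mathcomp Require Import all_solvable all_field all_character.

Set Implicit Arguments.
Unset Strict Implicit.
Unset Printing Implicit Defensive.

Import Order.TTheory GRing.Theory Num.Theory.
Local Open Scope ring_scope.

Definition is_partition (n : nat) (a : seq nat) : bool :=
  [&& sorted geq a, all (leq 1) a & sumn a == n].

(* For a sorted [a], the transpose has [head 0 a] parts. *)
Definition conj_partition (a : seq nat) : seq nat :=
  [seq count (ltn j) a | j <- iota 0 (head 0 a)].

(* (r_1^{k_1}, ..., r_m^{k_m}); r and k are only used on 1..m. *)
Definition exp_partition (m : nat) (r k : nat -> nat) : seq nat :=
  flatten [seq nseq (k i) (r i) | i <- iota 1 m].

Definition has_cycle_type (n : nat) (s : 'S_n) (b : seq nat) : bool :=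
  perm_eq [seq #|X| | X : {set 'I_n} in porbits s] b.

(* The Young subgroup S_{a_1} x S_{a_2} x ... of S_n: with 0..n-1 written row
   by row into the Young diagram of a, [reshape_index a j] is the row of j. *)
Definition young_subgroup (n : nat) (a : seq nat) : {set 'S_n} :=
  [set s : 'S_n | [forall j : 'I_n, reshape_index a (s j) == reshape_index a j]].

Lemma young_subgroup_group_set (n : nat) (a : seq nat) :
  group_set (young_subgroup n a).
Proof.
apply/group_setP; split=> [|s t]; first by rewrite inE; apply/forallP=> j; rewrite perm1.
rewrite !inE => /forallP hs /forallP ht; apply/forallP=> j.
by rewrite permM (eqP (ht _)) (eqP (hs _)).
Qed.

Canonical young_group (n : nat) (a : seq nat) : {group 'S_n} :=
  Group (young_subgroup_group_set n a).

Lemma sign_cfun_subproof (n : nat) :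
  is_class_fun <<[set: 'S_n]>>%g [ffun s : 'S_n => ((-1) ^+ odd_perm s : algC)].
Proof.
rewrite genGid; apply: intro_class_fun => [s t _ _ | s]; last by rewrite inE.
by rewrite odd_permJ.
Qed.

Definition sign_cfun (n : nat) : 'CF([set: 'S_n]) :=
  Cfun 0 (sign_cfun_subproof n).

(* 'chi_i is the irreducible character of S_n labeled by the partition a:
   the unique irreducible constituent common to the trivial character induced
   from S_a and the sign character induced from S_{a'}, with a' the transpose
   (James and Kerber's definition of [a]; with it, (n) labels the trivial
   character and (1^n) the sign character). *)
Definition labeled_by (n : nat) (a : seq nat) (i : Iirr [set: 'S_n]) : bool :=
  (i \in irr_constt ('Ind[[set: 'S_n], young_group n a] 1)) &&
  (i \in irr_constt ('Ind[[set: 'S_n], young_group n (conj_partition a)]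
                       ('Res[young_group n (conj_partition a)] (sign_cfun n)))).

Section Bounds.

Variables (n m : nat) (r k : nat -> nat).

(* The expression r_i + r_j - sum_{t <= p} k_t - sum_{t <= q} k_t, replaced
   as a whole by n as soon as r_0 or k_{m+1} occurs in it; r_{m+1} = 0. *)
Definition rk_expr (i j p q : nat) : int :=
  let r' t : nat := if (t <= m)%N then r t else 0%N in
  if [|| i == 0%N, j == 0%N, (m < p)%N | (m < q)%N] then n%:Z
  else (r' i)%:Z + (r' j)%:Z - \sum_(1 <= t < p.+1) (k t)%:Z
                             - \sum_(1 <= t < q.+1) (k t)%:Z.

(* Extremum of f over the nonempty range 0 <= i < l. *)
Definition max_lt (l : nat) (f : nat -> int) : int :=
  \big[Order.max/f 0%N]_(0 <= i < l) f i.
Definition min_lt (l : nat) (f : nat -> int) : int :=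
  \big[Order.min/f 0%N]_(0 <= i < l) f i.

(* For v >= 2 and i in the ranges below, no natural-number subtraction
   truncates: i <= v - 2 in the N bounds and i <= v - 1 in the E bounds. *)
Definition aN (v : nat) : int := max_lt (v - 1) (fun i =>
  rk_expr (v - i) (v + i) (v - i - 1) (v + i - 1)).
Definition bN (v : nat) : int := min_lt (v - 1) (fun i =>
  rk_expr (v - i - 1) (v + i - 1) (v - i - 1) (v + i - 1)).
Definition cN (v : nat) : int := max_lt (v - 1) (fun i =>
  rk_expr (v - i - 1) (v + i) (v - i - 2) (v + i - 1)).
Definition dN (v : nat) : int := min_lt (v - 1) (fun i =>
  rk_expr (v - i - 2) (v + i - 1) (v - i - 2) (v + i - 1)).

Definition aE (v : nat) : int := max_lt v (fun i =>
  rk_expr (v - i) (v + i) (v - i - 1) (v + i - 1)).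
Definition bE (v : nat) : int := min_lt v (fun i =>
  rk_expr (v - i - 1) (v + i - 1) (v - i - 1) (v + i - 1)).
Definition cE (v : nat) : int := max_lt v (fun i =>
  rk_expr (v - i) (v + i + 1) (v - i - 1) (v + i)).
Definition dE (v : nat) : int := min_lt v (fun i =>
  rk_expr (v - i - 1) (v + i) (v - i - 1) (v + i)).

End Bounds.

(* Main.v *)
(** By the Jacobi-Trudi determinant the character labelled by alpha is, up to
    sign, the alternating sum over w of the permutation characters of S_n on
    words in which the letter i occurs gamma_i - delta_(w i) times, where
    gamma_i = alpha_i + l - 1 - i is the set of beta-numbers.  This virtual
    character has norm 1 by Pieri's rule, and among its terms only the one with
    w = 1 meets a constituent of the sign character induced from the transposed
    Young subgroup.  At a permutation with a cycle of length x the alternating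
    sum cancels when no gamma_i - x is a new nonnegative beta-number, that is,
    when alpha has no hook of length x.  The hook lengths of a self-conjugate
    alpha are read off block by block from the r_i and k_i: the interval
    conditions say that x is at least every hook bound from above on the blocks
    beyond some antidiagonal and at most every bound from below on the others. *)

Require Import Defs.
From HB Require Import structures.
From mathcomp Require Import all_boot all_order all_algebra all_fingroup.
From mathcomp Require Import all_solvable all_field all_character.
From mathcomp Require Import zify.

Set Implicit Arguments.
Unset Strict Implicit.
Unset Printing Implicit Defensive.

Import Order.TTheory GRing.Theory Num.Theory.
Local Open Scope ring_scope.

(** * Permutation characters of S_n on words with prescribed content *)

Section Words.

Variables (n : nat) (T : finType).
Implicit Types (f g : {ffun 'I_n -> T}) (s y : 'S_n).

Definition wfix s f : bool := [forall p, f (s p) == f p].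

Definition content f : {ffun T -> nat} := [ffun t => #|[pred p | f p == t]|].

Lemma wfixP s f : reflect (forall p, f (s p) = f p) (wfix s f).
Proof. exact: 'forall_eqP. Qed.

Lemma count_content f t : count_mem t [seq f p | p <- enum 'I_n] = content f t.
Proof.
rewrite ffunE cardE count_map -size_filter enumT.
by congr size; apply: eq_filter => p; rewrite inE.
Qed.

Lemma sum_content f : (\sum_t content f t = n)%N.
Proof.
rewrite -[RHS]card_ord -sum1_card (partition_big f predT) //=.
by apply: eq_bigr => t _; rewrite ffunE -sum1_card; apply: eq_bigl.
Qed.

Lemma content_le f t : (content f t <= n)%N.
Proof. by rewrite ffunE -[leqRHS]card_ord max_card. Qed.

Lemma content_perm f y : content [ffun p => f (y p)] = content f.
Proof.
apply/ffunP => t; rewrite !ffunE -!sum1_card [RHS](reindex_inj (@perm_inj _ y)).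
by apply: eq_bigl => p; rewrite !inE ffunE.
Qed.

Lemma content_exists (c : T -> nat) :
  (\sum_t c t = n)%N -> exists f, forall t, content f t = c t.
Proof.
move=> cn; pose w := flatten [seq nseq (c t) t | t <- enum T].
have wn : size w = n.
  rewrite size_flatten /shape -map_comp sumnE big_map big_enum -cn.
  by apply: eq_bigr => t _ /=; rewrite size_nseq.
have wt t : count_mem t w = c t.
  rewrite count_flatten -map_comp sumnE big_map big_enum (bigD1 t) //= big1.
    by rewrite count_nseq /= eqxx mul1n addn0.
  by move=> u ut; rewrite count_nseq /= (negPf ut).
have wn' : size w == n by rewrite wn.
exists [ffun p => tnth (Tuple wn') p].
move=> t; rewrite -wt -[w]/(tval (Tuple wn')) -[in RHS](map_tnth_enum (Tuple wn')).
rewrite -count_content; congr (count_mem t _).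
by apply: eq_map => p; rewrite ffunE.
Qed.

Lemma content_transitive f g : content f = content g -> exists y, forall p, g p = f (y p).
Proof.
move=> fg.
have /tuple_permP[y gy] : perm_eq [tuple g p | p < n] [tuple f p | p < n].
  by apply/allP => t _ /=; rewrite !count_content fg.
exists y => p; have := congr1 (fun w => nth (g p) w p) gy.
rewrite (nth_map p) ?size_enum_ord // nth_ord_enum => ->.
by rewrite (nth_map p) ?size_enum_ord // nth_ord_enum tnth_mktuple.
Qed.

Section Stabilizer.

Variables (f0 : {ffun 'I_n -> T}) (H : {group 'S_n}).
Hypothesis HE : forall s, (s \in H) = wfix s f0.

(** In the induction formula [s ^ y] lies in [H] exactly when [s] fixes the rearranged word [F y].
    The [y] giving one and the same word form a left coset of [H], so each fixed word is counted
    #|H| times, which the factor in front cancels. *)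
Lemma Ind_stabilizer s : 'Ind[[set: 'S_n], H] 1 s =
  #|[set f | wfix s f & content f == content f0]|%:R.
Proof.
rewrite cfIndE ?subsetT //.
pose F y : {ffun 'I_n -> T} := [ffun p => f0 (y p)].
have conjE y : (s ^ y \in H)%g = wfix s (F y).
  rewrite HE; apply/wfixP/wfixP => fix_f p; last first.
    have := fix_f ((y^-1)%g p); rewrite !ffunE permKV => <-.
    by rewrite conjgE !permM.
  have := fix_f (y p); rewrite conjgE !permM permK !ffunE => <- //.
rewrite (eq_bigr (fun y => ((s ^ y \in H)%g)%:R)); last first.
  by move=> y _; rewrite cfun1E.
rewrite -natr_sum big_mkcond /=.
transitivity (#|H|%:R^-1 * (\sum_(f in [set f | wfix s f & content f == content f0]) #|H|)%:R : algC); last first.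
  by rewrite sum_nat_const natrM mulrC mulfK // neq0CG.
congr (_ * _%:R); rewrite (partition_big F predT) //= [RHS]big_mkcond /=.
apply: eq_bigr => f _; rewrite inE.
case: ifP => [/andP[sf /eqP cf]|Nf].
  have [y0 fy0] := content_transitive (esym cf).
  have -> : #|H| = #|(y0 *: H)%g| by rewrite card_lcoset.
  rewrite -sum1_card [RHS]big_mkcond [LHS]big_mkcond; apply: eq_bigr => y _.
  rewrite inE conjE mem_lcoset HE.
  suff -> : wfix (y0^-1 * y)%g f0 = (F y == f).
    by case: eqP => // ->; rewrite sf.
  apply/wfixP/eqP => [h|yf p].
    by apply/ffunP => p; rewrite ffunE fy0 -(h (y0 p)) permM permK.
  by rewrite permM; have := fy0 ((y0^-1)%g p); rewrite permKV -yf ffunE => <-.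
rewrite big1 // => y /eqP Fy; rewrite inE conjE Fy.
by case: wfix Nf => //; rewrite -Fy content_perm eqxx.
Qed.

End Stabilizer.

Lemma stabilizer_group_set f : group_set [set s : 'S_n | wfix s f].
Proof.
apply/group_setP; split=> [|s t].
  by rewrite inE; apply/wfixP => p; rewrite perm1.
rewrite !inE => /wfixP fs /wfixP ft; apply/wfixP => p.
by rewrite permM ft fs.
Qed.

Canonical stabilizer_group f := Group (stabilizer_group_set f).

Lemma wordcf_subproof (P : pred {ffun T -> nat}) : is_class_fun <<[set: 'S_n]>>%g
  [ffun s : 'S_n => #|[set f | wfix s f & P (content f)]|%:R : algC].
Proof.
rewrite genGid; apply: intro_class_fun => [s y _ _ | s]; last by rewrite inE.
congr _%:R; pose F (z : 'S_n) f : {ffun 'I_n -> T} := [ffun p => f (z p)].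
have FK z : cancel (F z) (F z^-1%g).
  by move=> f; apply/ffunP => p; rewrite !ffunE permKV.
rewrite -[RHS](card_imset _ (can_inj (FK y^-1%g))).
apply: eq_card => f; rewrite inE.
have wJ g : wfix (s ^ y)%g g = wfix s (F y g).
  apply/wfixP/wfixP => h p.
    by have := h (y p); rewrite conjgE !permM permK !ffunE.
  by have := h (y^-1%g p); rewrite conjgE !permM !ffunE permKV.
apply/andP/imsetP => [[fs Pf]|[g]].
  by exists (F y f); rewrite ?FK // inE content_perm Pf -wJ fs.
rewrite inE => /andP[gs Pg] ->; rewrite content_perm wJ.
by have := FK y^-1%g g; rewrite invgK => ->; rewrite gs Pg.
Qed.

(** Contents are selected by a predicate, so that a predicate with no solution simply gives the zero
    class function. *)
Definition wordcf (P : pred {ffun T -> nat}) : 'CF([set: 'S_n]) :=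
  Cfun 0 (wordcf_subproof P).

Lemma wordcfE P s : wordcf P s = #|[set f | wfix s f & P (content f)]|%:R.
Proof. by rewrite cfunE. Qed.

(** If [P] admits at most one content, the words concerned form one orbit or none: the function is a
    trivial character induced from a stabilizer, or 0. *)
Lemma wordcf_char (P : pred {ffun T -> nat}) :
  (forall c d, P c -> P d -> c = d) -> wordcf P \is a character.
Proof.
move=> Pinj; case: (pickP [pred f | P (content f)]) => [f0 /= Pf0|noP].
  suff -> : wordcf P = 'Ind[[set: 'S_n], stabilizer_group f0] 1.
    by rewrite cfInd_char // cfun1_char.
  apply/cfunP => s; rewrite (@Ind_stabilizer f0) => [|t]; last by rewrite inE.
  rewrite wordcfE; congr _%:R; apply: eq_card => f; rewrite !inE.
  by congr andb; apply/idP/eqP => [Pf|->//]; exact: Pinj.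
suff -> : wordcf P = 0 by exact: cfun0_char.
apply/cfunP => s; rewrite wordcfE cfunE (_ : [set f | _] = set0) ?cards0 //.
by apply/setP => f; rewrite !inE; have /= -> := noP f; rewrite andbF.
Qed.

(* Burnside: words with a given content form a single orbit. *)
Lemma sum_wfix_content (c : {ffun T -> nat}) : (\sum_t c t = n)%N ->
  (\sum_(s : 'S_n) #|[set f | wfix s f & content f == c]|%:R = n`!%:R :> algC).
Proof.
move=> /content_exists[f0 f0c].
have {f0c} <- : content f0 = c by apply/ffunP.
have Hf s : (s \in stabilizer_group f0) = wfix s f0 by rewrite inE.
have := Frobenius_reciprocity (1 : 'CF(stabilizer_group f0)) (1 : 'CF([set: 'S_n])).
rewrite cfRes_cfun1 ?subsetT // cfnorm1 cfdotE.
rewrite (eq_bigr (fun s => #|[set f | wfix s f & content f == content f0]|%:R)).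
  move/(congr1 ( *%R (#|[set: 'S_n]|%:R))); rewrite mulr1 mulVKf ?neq0CG //.
  rewrite cardsT card_Sn => ->; apply: eq_bigl => s; by rewrite inE.
by move=> s _; rewrite cfun1E inE conjC1 mulr1 (Ind_stabilizer Hf).
Qed.

(** Burnside's count is applied to each content separately. Multiplicities are at most [n], so the
    bound [B] makes the contents a finite type without losing any. *)
Lemma sum_wfix (B : nat) (P : pred {ffun T -> nat}) : (n < B)%N ->
  (\sum_(s : 'S_n) #|[set f | wfix s f & P (content f)]|%:R =
   n`!%:R * #|[set c : {ffun T -> 'I_B} |
       (\sum_t c t == n)%N && P [ffun t => c t : nat]]|%:R :> algC).
Proof.
case: B => // B nB; pose C f : {ffun T -> 'I_B.+1} := [ffun t => inord (content f t)].
have CE f : [ffun t => C f t : nat] = content f.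
  apply/ffunP => t; rewrite ffunE [in LHS]ffunE inordK //.
  by rewrite ltnS (leq_trans (content_le _ _)).
rewrite -sum1_card natr_sum mulr_sumr.
transitivity (\sum_(c : {ffun T -> 'I_B.+1}) \sum_(s : 'S_n)
   #|[set f | [&& wfix s f, P (content f) & C f == c]]|%:R : algC).
  rewrite exchange_big; apply: eq_bigr => s _ /=.
  rewrite -sum1_card natr_sum (partition_big C predT) //=.
  apply: eq_bigr => c _; rewrite -sum1_card natr_sum.
  by apply: eq_bigl => f; rewrite !inE -!andbA.
rewrite [RHS]big_mkcond /=; apply: eq_bigr => c _; rewrite inE.
have CEc f : (C f == c) = (content f == [ffun t => c t : nat]).
  apply/eqP/eqP => [<-|fc]; first by rewrite CE.
  by apply/ffunP => t; apply/val_inj; rewrite /= -[RHS](ffunE (fun t => c t : nat)) -fc -CE ffunE.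
case: ifP => [/andP[/eqP cn Pc]|Nc].
  rewrite mulr1 -(@sum_wfix_content [ffun t => c t : nat]); last first.
    by rewrite -[RHS]cn; apply: eq_bigr => t _; rewrite ffunE.
  apply: eq_bigr => s _; congr _%:R; apply: eq_card => f; rewrite !inE CEc.
  by case: eqP => [->|]; rewrite ?andbF // Pc.
rewrite big1 // => s _; rewrite (_ : [set f | _] = set0) ?cards0 //.
apply/setP => f; rewrite !inE CEc; case: eqP => [fc|]; last by rewrite !andbF.
rewrite fc !andbT; case Pc : (P _); last by rewrite andbF.
move: Nc; rewrite Pc andbT -[X in _ == X](sum_content f) fc.
by under [X in _ == X]eq_bigr do rewrite ffunE; rewrite eqxx.
Qed.

End Words.

Lemma card_reindex (T : finType) (P : pred T) (F : T -> T) :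
  injective F -> #|[set c | P (F c)]| = #|[set c | P c]|.
Proof. by move=> Finj; rewrite -!sum1dep_card [RHS](reindex_inj Finj). Qed.

(** This closes every sign-reversing involution below: reindexing by the involution turns the sum
    into its own opposite. *)
Lemma eq_opp_self0 (z : algC) : z = - z -> z = 0.
Proof.
move/eqP; rewrite -subr_eq0 opprK -mulr2n -mulr_natr mulf_eq0 pnatr_eq0 orbF.
by move/eqP.
Qed.

(** * Signed counts of matrices with given margins, and Pieri's rule *)

Section AlternatingCount.

Variables l B : nat.
Implicit Types (k : nat) (mu a : nat -> nat).

Definition delta (i : nat) : nat := (l - i.+1)%N.

(* For gamma = a + delta this is the inner product of the Jacobi-Trudi
   determinant of the shape a with the complete symmetric function h_mu. *)
Definition altcount k mu (gamma : 'I_l -> nat) : algC :=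
  \sum_(w : 'S_l) (-1) ^+ w *
    #|[set c : {ffun 'I_l * 'I_k -> 'I_B.+1} |
       [forall i, (\sum_j c (i, j) + delta (w i))%N == gamma i] &&
       [forall j, (\sum_i c (i, j))%N == mu (nat_of_ord j)]]|%:R.

Lemma eq_altcount k mu g g' : g =1 g' -> altcount k mu g = altcount k mu g'.
Proof.
move=> eqg; apply: eq_bigr => w _; congr (_ * _%:R).
apply: eq_card => c; rewrite !inE; congr andb; apply: eq_forallb => i.
by rewrite eqg.
Qed.

(** This is the antisymmetry of a determinant in its rows: replace [w] by [s * w] and permute the
    rows of the matrix [c] accordingly. *)
Lemma altcount_perm k mu (gamma : 'I_l -> nat) (s : 'S_l) :
  altcount k mu (fun i => gamma (s i)) = (-1) ^+ s * altcount k mu gamma.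
Proof.
rewrite /altcount mulr_sumr (reindex_inj (@mulgI _ s)) /=; apply: eq_bigr => w _.
rewrite odd_permM signr_addb mulrA; congr (_ * _%:R).
pose F (c : {ffun 'I_l * 'I_k -> 'I_B.+1}) : {ffun 'I_l * 'I_k -> 'I_B.+1} :=
  [ffun p => c (s p.1, p.2)].
have Finj : injective F.
  move=> c d /ffunP cd; apply/ffunP => -[i j].
  by have := cd ((s^-1)%g i, j); rewrite !ffunE /= permKV.
rewrite -(card_reindex _ Finj); apply: eq_card => c; rewrite !inE.
congr andb.
  apply/forallP/forallP => /= h i.
    have := h ((s^-1)%g i); rewrite permM !permKV => /eqP <-; apply/eqP; congr addn.
    by apply: eq_bigr => j _; rewrite ffunE /= permKV.
  have /eqP <- := h (s i); rewrite permM; apply/eqP; congr addn.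
  by apply: eq_bigr => j _; rewrite ffunE.
apply: eq_forallb => j; congr (_ == _).
rewrite [RHS](reindex_inj (@perm_inj _ s)) /=.
by apply: eq_bigr => i _; rewrite ffunE.
Qed.

Lemma altcount0 mu : altcount 0 mu (fun i => delta i) = 1.
Proof.
rewrite /altcount (bigD1 (1%g : 'S_l)) //= big1 => [|w w1].
  rewrite odd_perm1 mul1r addr0 (_ : [set c | _] = setT).
    by rewrite cardsT card_ffun card_prod !card_ord muln0 expn0.
  apply/setP => c; rewrite !inE; apply/andP; split; apply/forallP => i; last by case: i.
  by rewrite big_ord0 perm1.
rewrite (_ : [set c | _] = set0) ?cards0 ?mulr0 //.
apply/setP => c; rewrite !inE; apply: contraNF w1 => /andP[/forallP h _].
apply/eqP/permP => i; rewrite perm1; apply/val_inj => /=.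
have := h i; rewrite big_ord0 add0n /delta.
by have := ltn_ord i; have := ltn_ord (w i); lia.
Qed.

(** The first column is split off; [g] is what it leaves of [gamma], and its sum [mu 0] fixes the
    total of [g]. This is Pieri's rule before any cancellation. *)
Lemma altcountS k mu (gamma : 'I_l -> nat) : (forall i, gamma i <= B)%N ->
  altcount k.+1 mu gamma =
  \sum_(g : {ffun 'I_l -> 'I_B.+1} | [forall i, (g i <= gamma i)%N] &&
        (\sum_i gamma i == \sum_i g i + mu 0)%N)
    altcount k (fun j => mu j.+1) (fun i => g i).
Proof.
move=> gammaB; rewrite /altcount exchange_big; apply: eq_bigr => w _ /=.
rewrite -mulr_sumr; congr (_ * _); rewrite -sum1dep_card natr_sum.
under [RHS]eq_bigr do rewrite -sum1dep_card natr_sum.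
rewrite pair_big_dep /=.
pose join (q : {ffun 'I_l -> 'I_B.+1} * {ffun 'I_l * 'I_k -> 'I_B.+1}) :
    {ffun 'I_l * 'I_k.+1 -> 'I_B.+1} :=
  [ffun p => if unlift ord0 p.2 is Some j then q.2 (p.1, j)
             else inord (gamma p.1 - q.1 p.1)].
pose split (c : {ffun 'I_l * 'I_k.+1 -> 'I_B.+1}) :
    {ffun 'I_l -> 'I_B.+1} * {ffun 'I_l * 'I_k -> 'I_B.+1} :=
  ([ffun i => inord (gamma i - c (i, ord0))], [ffun p => c (p.1, lift ord0 p.2)]).
have subB (i : 'I_l) (m : nat) : (gamma i - m < B.+1)%N.
  by rewrite ltnS (leq_trans (leq_subr _ _)).
have join0 q i : join q (i, ord0) = (gamma i - q.1 i)%N :> nat.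
  by rewrite ffunE unlift_none inordK.
have joinS q i j : join q (i, lift ord0 j) = q.2 (i, j).
  by rewrite ffunE liftK.
rewrite (reindex_onto join split) /=; last first.
  move=> c /andP[/forallP rows _]; apply/ffunP => -[i j]; rewrite ffunE /=.
  case: unliftP => [j' ->|->]; first by rewrite ffunE.
  apply/val_inj; rewrite ffunE /= !inordK //.
  have /eqP <- := rows i; rewrite big_ord_recl; lia.
apply: eq_bigl => -[g c] /=.
have -> : (split (join (g, c)) == (g, c)) = [forall i, (g i <= gamma i)%N].
  apply/eqP/forallP => [[/ffunP gE _] i|le_g].
    have /(congr1 val) := gE i; rewrite ffunE /= join0 /= inordK //; lia.
  congr pair; apply/ffunP; last by case=> i j; rewrite ffunE joinS.
  move=> i; rewrite ffunE; apply/val_inj; rewrite /= join0 /= inordK //; have := le_g i; lia.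
rewrite -!andbA; case: forallP => [le_g|_]; last by rewrite !andbF.
rewrite andbT /= andbCA; congr andb.
  apply: eq_forallb => i; rewrite big_ord_recl join0 /=.
  under eq_bigr do rewrite joinS.
  by have := le_g i; rewrite /=; lia.
have sumE : (\sum_i (gamma i - g i) = \sum_i gamma i - \sum_i g i)%N.
  by rewrite sumnB.
have le_sum : (\sum_i g i <= \sum_i gamma i)%N by apply: leq_sum.
apply/forallP/andP => [h|[h0 /forallP hS] j].
  split; last first.
    apply/forallP => j; have := h (lift ord0 j); rewrite /= /bump /= add1n.
    by under eq_bigr do rewrite joinS.
  have := h ord0; under eq_bigr do rewrite join0 /=.
  by rewrite sumE => /eqP <-; rewrite subnKC.
case: (unliftP ord0 j) => [j' ->|->].
  by under eq_bigr do rewrite joinS; apply: hS.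
under eq_bigr do rewrite join0 /=; by rewrite sumE (eqP h0) addKn.
Qed.

(* Swapping rows t and t+1 at the first place where g fails to interlace with
   gamma is an involution, so only horizontal strips survive. *)
Lemma interlacing_sum (K : {ffun 'I_l -> 'I_B.+1} -> algC) a m :
  (forall i, (a i.+1 <= a i)%N) -> a l = 0%N ->
  (forall (g : {ffun 'I_l -> 'I_B.+1}) (i j : 'I_l), i != j -> K [ffun h => g (tperm i j h)] = - K g) ->
  \sum_(g : {ffun 'I_l -> 'I_B.+1} | [forall i : 'I_l, (g i <= a i + delta i)%N] &&
        (\sum_(i < l) (a i + delta i) == \sum_i g i + m)%N) K g =
  \sum_(g : {ffun 'I_l -> 'I_B.+1} | [forall i : 'I_l, (a i.+1 + delta i <= g i <= a i + delta i)%N] &&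
        (\sum_(i < l) (a i + delta i) == \sum_i g i + m)%N) K g.
Proof.
move=> a_dec al0 Kswap.
(* [P t] demands interlacing only in the rows before [t]; it passes from the left-hand condition at
   0 to the right-hand one at [l]. *)
pose P t (g : {ffun 'I_l -> 'I_B.+1}) :=
  [forall i : 'I_l, (g i <= a i + delta i)%N && ((i < t)%N ==> (a i.+1 + delta i <= g i)%N)]
  && (\sum_(i < l) (a i + delta i) == \sum_i g i + m)%N.
have step t : (t <= l)%N -> \sum_(g | P 0%N g) K g = \sum_(g | P t g) K g.
  elim: t => // t IHt lt_tl; rewrite {}IHt 1?ltnW //.
  pose it := Ordinal lt_tl.
  rewrite (bigID (fun g : {ffun 'I_l -> 'I_B.+1} => (a t.+1 + delta t <= g it)%N)) /=.
  rewrite [X in _ + X](_ : _ = 0) ?addr0.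
    apply: eq_bigl => g; rewrite /P andbAC; congr andb.
    apply/andP/forallP => [[/forallP h ht] i|h]; last first.
      split; last by have := h it; rewrite /= ltnSn; lia.
      by apply/forallP => i; have := h i; lia.
    have := h i; case: (ltngtP i t) => [it'|it'|it'] /=; try lia.
    have -> : i = it by apply: val_inj.
    by rewrite /= ht ltnSn /= andbT.
  (* In the last row the lower bound [a l + delta t] is 0, so interlacing cannot fail there. *)
  have [tl|tl] := ltnP t.+1 l; last first.
    have tE : t.+1 = l by lia.
    have dt : delta t = 0%N by rewrite /delta; lia.
    by rewrite big_pred0 // => g; rewrite tE al0 dt andbF.
  pose jt := Ordinal tl.
  have neq_ij : it != jt by apply/eqP => /(congr1 val) /=; lia.
  pose F (g : {ffun 'I_l -> 'I_B.+1}) : {ffun 'I_l -> 'I_B.+1} :=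
    [ffun h => g (tperm it jt h)].
  have FK : involutive F by move=> g; apply/ffunP => i; rewrite !ffunE tpermK.
  apply: eq_opp_self0; rewrite -sumrN [LHS](reindex_inj (inv_inj FK)) /=.
  apply: eq_big => [g|g _]; last by rewrite Kswap.
  suff impl g' : P t g' && ~~ (a t.+1 + delta t <= g' it)%N ->
                 P t (F g') && ~~ (a t.+1 + delta t <= F g' it)%N.
    by apply/idP/idP => /impl; rewrite ?FK.
  case/andP=> /andP[/forallP h sum_g] bad_g.
  (* As [delta t] exceeds [delta t.+1] by one, failure at row [t] puts [g it] at most
     [a t.+1 + delta t.+1], which also bounds [g jt]. The two values can therefore trade places, and
     row [t] still fails. *)
  have := a_dec t; have := h it; have := h jt; rewrite /= => hj hi dec.
  have -> : F g' it = g' jt by rewrite ffunE tpermL.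
  apply/andP; split; last by move: bad_g hj; rewrite /delta; lia.
  apply/andP; split; last first.
    rewrite (eqP sum_g) [X in (_ == X + _)%N](reindex_inj (@perm_inj _ (tperm it jt))).
    by apply/eqP; congr addn; apply: eq_bigr => i _; rewrite ffunE tpermK.
  apply/forallP => i; rewrite ffunE; case: tpermP => [->|->|/eqP ni /eqP nj] /=.
  - by move: bad_g hj hi; rewrite /delta; lia.
  - by move: bad_g hj hi; rewrite /delta; lia.
  - exact: h.
transitivity (\sum_(g | P 0%N g) K g); first by apply: eq_bigl => g; congr andb; apply: eq_forallb => i; rewrite andbT.
rewrite (step l) //; apply: eq_bigl => g; congr andb; apply: eq_forallb => i.
by rewrite ltn_ord andbC.
Qed.

Lemma sum_shift a : a l = 0%N ->
  (\sum_(i < l) (a i + delta i) = \sum_(i < l) (a i.+1 + delta i) + a 0)%N.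
Proof.
move=> al0; rewrite !big_split /= addnAC; congr addn.
by rewrite addnC -(big_ord_recl l (fun i => a i)) big_ord_recr /= al0 addn0.
Qed.

(** A horizontal strip removed from [a] has at most [a 0] cells, and reaches this size only if each
    row [i] shrinks to length [a i.+1]. So when [mu 0] is at least [a 0], at most one term
    survives. *)
Lemma altcount_strip k mu a :
  (forall i, (a i.+1 <= a i)%N) -> a l = 0%N -> (a 0 + l <= B)%N -> (a 0 <= mu 0)%N ->
  altcount k.+1 mu (fun i => a i + delta i)%N =
  if mu 0%N == a 0%N then altcount k (fun j => mu j.+1) (fun i => a i.+1 + delta i)%N
  else 0.
Proof.
move=> a_dec al0 a0B a0mu.
have a_le i : (a i <= a 0)%N by elim: i => // i; apply: leq_trans.
have aB (i : 'I_l) : (a i + delta i <= B)%N.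
  by have := a_le i; have := ltn_ord i; rewrite /delta; lia.
rewrite altcountS // (@interlacing_sum (fun g => altcount k _ (fun i => g i)) a) //.
  rewrite sum_shift //.
  have [mu0|neq_mu] := eqVneq (mu 0%N) (a 0%N); last first.
    rewrite big_pred0 // => g; apply/negP => /andP[/forallP h /eqP sumE].
    have : (\sum_(i < l) (a i.+1 + delta i) <= \sum_i g i)%N.
      by apply: leq_sum => i _; have /andP[] := h i.
    by move: sumE; move: (\sum_(i < l) _)%N (\sum_i _)%N => x y; lia.
  pose g0 : {ffun 'I_l -> 'I_B.+1} := [ffun i : 'I_l => inord (a i.+1 + delta i)].
  have g0E (i : 'I_l) : (a i.+1 + delta i = g0 i)%N.
    by rewrite ffunE inordK // ltnS (leq_trans _ (aB i)) // leq_add2r.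
  rewrite (big_pred1 g0) => [|g].
    by apply: eq_altcount => i; rewrite -g0E.
  rewrite mu0 eqn_add2r; apply/andP/eqP => [[/forallP h]|->]; last first.
    split; last by apply/eqP/eq_bigr => i _.
    by apply/forallP => i; rewrite -g0E leqnn leq_add2r a_dec.
  have le_g (i : 'I_l) : true -> (a i.+1 + delta i <= g i ?= iff (a i.+1 + delta i == g i))%N.
    by split=> //; have /andP[] := h i.
  rewrite (leqif_sum le_g) => /forallP eq_g; apply/ffunP => i; apply/val_inj.
  by rewrite /= -g0E; apply/esym/eqP/eq_g.
move=> g i j neq_ij.
rewrite -[RHS]mulN1r -[-1]expr1 -[X in _ ^+ X]/(nat_of_bool true) -(_ : odd_perm (tperm i j) = true).
  by rewrite -altcount_perm; apply: eq_altcount => h; rewrite ffunE.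
by rewrite odd_tperm neq_ij.
Qed.

(** This is the Kostka number of shape [a] and content [a]: each strip is as long as possible, hence
    forced, down to the empty shape. *)
Lemma altcount_diag k mu a :
  (forall i, (a i.+1 <= a i)%N) -> a l = 0%N -> (a 0 + l <= B)%N ->
  (forall i, (k <= i)%N -> a i = 0%N) -> (forall i, (i < k)%N -> mu i = a i) ->
  altcount k mu (fun i => a i + delta i)%N = 1.
Proof.
elim: k => [|k IHk] in mu a *; move=> a_dec al0 aB a0 mua.
  by rewrite -(altcount0 mu); apply: eq_altcount => i; rewrite a0.
rewrite altcount_strip ?mua // eqxx; apply: (IHk _ (fun i => a i.+1)) => //=.
- by apply/eqP; rewrite -leqn0 -al0.
- by rewrite (leq_trans _ aB) // leq_add2r.
- by move=> i ki; apply: a0.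
- by move=> i ki; apply: mua.
Qed.

(** The first [t] strips are forced; the next would need more cells than the current first row
    allows. What [mu] does after [t] is arbitrary, so [mu] may be unsorted. *)
Lemma altcount_lex0 k mu a t :
  (forall i, (a i.+1 <= a i)%N) -> a l = 0%N -> (a 0 + l <= B)%N ->
  (t < k)%N -> (forall i, (i < t)%N -> mu i = a i) -> (a t < mu t)%N ->
  altcount k mu (fun i => a i + delta i)%N = 0.
Proof.
elim: t => [|t IHt] in k mu a *; case: k => // k a_dec al0 aB tk mua lt_t.
  by rewrite altcount_strip ?(ltnW lt_t) // gtn_eqF.
rewrite altcount_strip ?mua // eqxx; apply: (IHt _ _ (fun i => a i.+1)) => //=.
- by apply/eqP; rewrite -leqn0 -al0.
- by rewrite (leq_trans _ aB) // leq_add2r.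
- by move=> i ti; apply: mua.
Qed.

End AlternatingCount.

(** A pair of words is one word in pairs of letters, whose content is a matrix with the two contents
    as row and column sums. Averaging the fixed points over S_n counts these matrices. *)
Lemma cfdot_wordcf (n : nat) (T1 T2 : finType) (B : nat)
    (P1 : pred {ffun T1 -> nat}) (P2 : pred {ffun T2 -> nat}) : (n < B)%N ->
  '[wordcf n P1, wordcf n P2] =
  #|[set c : {ffun T1 * T2 -> 'I_B} | (\sum_t c t == n)%N &&
       (P1 [ffun i => (\sum_j c (i, j))%N] && P2 [ffun j => (\sum_i c (i, j))%N])]|%:R.
Proof.
move=> nB; rewrite cfdotE cardsT card_Sn.
pose Q (c : {ffun T1 * T2 -> nat}) :=
  P1 [ffun i => (\sum_j c (i, j))%N] && P2 [ffun j => (\sum_i c (i, j))%N].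
transitivity (n`!%:R^-1 * (\sum_(s : 'S_n)
    #|[set h : {ffun 'I_n -> T1 * T2} | wfix s h & Q (content h)]|%:R) : algC); last first.
  rewrite (sum_wfix Q nB) mulKf ?pnatr_eq0 -?lt0n ?fact_gt0 //.
  congr _%:R; apply: eq_card => c; rewrite !inE; congr (_ && _).
  rewrite /Q; congr (P1 _ && P2 _); apply/ffunP => t; rewrite !ffunE.
    by apply: eq_bigr => j _; rewrite ffunE.
  by apply: eq_bigr => j _; rewrite ffunE.
congr (_ * _); rewrite big_mkcond; apply: eq_bigr => s _; rewrite inE !wordcfE.
rewrite conjC_nat -natrM -cardsX; congr _%:R.
pose F (h : {ffun 'I_n -> T1 * T2}) : {ffun 'I_n -> T1} * {ffun 'I_n -> T2} :=
  ([ffun p => (h p).1], [ffun p => (h p).2]).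
pose G (q : {ffun 'I_n -> T1} * {ffun 'I_n -> T2}) : {ffun 'I_n -> T1 * T2} :=
  [ffun p => (q.1 p, q.2 p)].
have FK : cancel F G by move=> h; apply/ffunP => p; rewrite !ffunE -surjective_pairing.
have GK : cancel G F by case=> f g; congr pair; apply/ffunP => p; rewrite !ffunE.
rewrite -!sum1_card (reindex F) /=; last by exists G => q _.
apply: eq_bigl => h; rewrite !inE /=.
have -> : wfix s h = wfix s (F h).1 && wfix s (F h).2.
  apply/wfixP/andP => [sh|[/wfixP s1 /wfixP s2] p].
    by split; apply/wfixP => p; rewrite !ffunE sh.
  have := s1 p; have := s2 p; rewrite !ffunE.
  by case: (h (s p)) (h p) => ? ? [? ?] /= -> ->.
have -> : content (F h).1 = [ffun i => (\sum_j content h (i, j))%N].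
  apply/ffunP => t; rewrite !ffunE -sum1_card (partition_big (fun p => (h p).2) predT) //=.
  apply: eq_bigr => j _; rewrite ffunE -sum1_card; apply: eq_bigl => p.
  by rewrite !inE ffunE (surjective_pairing (h p)) xpair_eqE.
have -> : content (F h).2 = [ffun j => (\sum_i content h (i, j))%N].
  apply/ffunP => t; rewrite !ffunE -sum1_card (partition_big (fun p => (h p).1) predT) //=.
  apply: eq_bigr => j _; rewrite ffunE -sum1_card; apply: eq_bigl => p.
  by rewrite !inE ffunE (surjective_pairing (h p)) xpair_eqE andbC.
by rewrite /Q -!andbA; congr andb; rewrite andbCA.
Qed.

(** The least moved point can only go up, since all smaller points are already images of themselves.
    At this point [delta] drops, which is what makes the terms with [w] other than 1
    lexicographically larger. *)
Lemma perm_first_moved (l : nat) (u : 'S_l) : u != 1%g ->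
  exists t : 'I_l, (forall i : 'I_l, (i < t)%N -> u i = i) /\ (t < u t)%N.
Proof.
move=> u1; have [t0 ut0] : exists t, u t != t.
  apply/existsP; apply: contraR u1 => /existsPn h; apply/eqP/permP => t.
  by rewrite perm1; apply/eqP; rewrite -[_ == _]negbK.
case: (@arg_minnP _ t0 (fun t => u t != t) (fun t : 'I_l => nat_of_ord t) ut0) => t ut t_min; exists t.
have fixed (i : 'I_l) : (i < t)%N -> u i = i.
  by move=> it; apply/eqP; apply: contraTT it => /t_min; rewrite -leqNgt.
split=> //; have [//|lt_ut|eq_ut] := ltngtP t (u t).
  by have /perm_inj E := fixed _ lt_ut; rewrite E eqxx in ut.
by rewrite -(inj_eq val_inj) /= -eq_ut eqxx in ut.
Qed.

(** * The Jacobi-Trudi virtual character and its vanishing *)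

Section JacobiTrudi.

Variables (n l : nat) (gamma : 'I_l -> nat).

(** The condition is an addition rather than a truncated subtraction: if [gamma i] is below
    [delta l (w i)] no content qualifies, in keeping with h_d = 0 for negative d. *)
Definition shifted (w : 'S_l) : pred {ffun 'I_l -> nat} :=
  [pred c : {ffun 'I_l -> nat} | [forall i, c i + delta l (w i) == gamma i]%N].

Lemma shifted_inj w c d : shifted w c -> shifted w d -> c = d.
Proof.
move=> /forallP hc /forallP hd; apply/ffunP => i; apply/eqP.
by rewrite -(eqn_add2r (delta l (w i))) (eqP (hc i)) (eqP (hd i)).
Qed.

(* Jacobi-Trudi: the determinant det (h_(gamma_i - delta_j)), expanded. *)
Definition jtcf : 'CF([set: 'S_n]) := \sum_(w : 'S_l) (-1) ^+ w *: wordcf n (shifted w).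

Lemma jtcf_vchar : jtcf \in 'Z[irr [set: 'S_n]]%g.
Proof.
apply: rpred_sum => w _; rewrite rpredZsign.
exact/char_vchar/wordcf_char/shifted_inj.
Qed.

(* Transposing the letters i and j outside the cycle of p0, where i is the
   letter on that cycle and gamma_j = gamma_i - x, is a sign-reversing
   involution. *)
Lemma jtcf_cycle0 (s : 'S_n) (p0 : 'I_n) :
  (forall i, #|porbit s p0| <= gamma i -> exists j, gamma j + #|porbit s p0| = gamma i)%N ->
  jtcf s = 0.
Proof.
set X := porbit s p0 => hook; have X_gt0 : (0 < #|X|)%N by rewrite lt0n card_porbit_neq0.
have sX p : (s p \in X) = (p \in X).
  by rewrite -!eq_porbit_mem (eqP (_ : porbit s (s p) == porbit s p)) // eq_porbit_mem -[s]expg1 mem_porbit.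
have fX (f : {ffun 'I_n -> 'I_l}) p : wfix s f -> p \in X -> f p = f p0.
  move=> /wfixP sf; rewrite /X porbit_traject => /trajectP[h _ ->].
  by elim: h => //= h IHh; rewrite sf.
pose off (f : {ffun 'I_n -> 'I_l}) i := #|[pred p | (p \notin X) && (f p == i)]|.
have contentE f : wfix s f -> forall i, content f i = (off f i + (f p0 == i) * #|X|)%N.
  move=> sf i; rewrite ffunE -[LHS]sum1_card (bigID (mem X)) /= [LHS]addnC; congr addn.
    by rewrite /off -sum1_card; apply: eq_bigl => p; rewrite !inE andbC.
  rewrite -sum1_card mulnC -[RHS](_ : (\sum_(p in X) (f p0 == i) = _)%N).
    rewrite [RHS]big_mkcond [LHS]big_mkcond; apply: eq_bigr => p _ /=.
    by rewrite inE; case pX: (p \in X); rewrite ?andbF // andbT fX //; case: eqP.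
  by rewrite sum_nat_const sum1_card.
rewrite /jtcf sum_cfunE.
transitivity (\sum_(i : 'I_l) \sum_(w : 'S_l) (-1) ^+ w *
  #|[set f | [&& wfix s f, shifted w (content f) & f p0 == i]]|%:R : algC).
  rewrite exchange_big; apply: eq_bigr => w _ /=.
  rewrite cfunE wordcfE -mulr_sumr; congr (_ * _).
  rewrite -sum1_card natr_sum (partition_big (fun f : {ffun 'I_n -> 'I_l} => f p0) predT) //=.
  apply: eq_bigr => i _; rewrite -sum1_card natr_sum; apply: eq_bigl => f.
  by rewrite !inE -andbA.
(* A fixed word with letter [i] on the cycle uses [i] at least #|X| times, so there is none if
   [gamma i] is smaller. *)
apply: big1 => i _; have [lt_i|] := ltnP (gamma i) #|X|.
  apply: big1 => w _; rewrite (_ : [set f | _] = set0) ?cards0 ?mulr0 //.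
  apply/setP => f; rewrite !inE; apply/negP => /and3P[sf /forallP/(_ i) h /eqP fi].
  move: h; rewrite contentE // fi eqxx; lia.
case/hook => j ij; have neq_ij : i != j by apply/eqP => E; move: ij; rewrite E; lia.
pose tau := tperm i j.
pose F (f : {ffun 'I_n -> 'I_l}) : {ffun 'I_n -> 'I_l} :=
  [ffun p => if p \in X then f p else tau (f p)].
have FK : involutive F.
  by move=> f; apply/ffunP => p; rewrite !ffunE; case: (p \in X); rewrite // /tau tpermK.
have p0X : p0 \in X by apply: porbit_id.
have F0 f : F f p0 = f p0 by rewrite ffunE p0X.
have offF f h : off (F f) h = off f (tau h).
  apply: eq_card => p; rewrite !inE ffunE; case: (p \in X) => //=.
  by rewrite -(inj_eq (@perm_inj _ tau)) /tau tpermK.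
apply: eq_opp_self0; rewrite -sumrN [LHS](reindex_inj (@mulgI _ tau)) /=.
apply: eq_bigr => w _; rewrite odd_permM odd_tperm neq_ij signr_addb expr1 mulN1r mulNr.
congr (- (_ * _%:R)); rewrite -(card_reindex _ (inv_inj FK)).
apply: eq_card => f; rewrite !inE F0.
have -> : wfix s (F f) = wfix s f.
  apply/wfixP/wfixP => h p; have := h p; rewrite !ffunE sX; case: ifP => // _.
    exact: perm_inj.
  by move->.
case sf: (wfix s f) => //=; case: (f p0 =P i) => [fi|]; last by rewrite !andbF.
rewrite !andbT.
have sF : wfix s (F f).
  by apply/wfixP => p; rewrite !ffunE sX; move/wfixP: sf => ->.
have cF := contentE _ sF; have cf := contentE _ sf.
move: cF cf; rewrite F0 fi => cF cf.
have tauK k : tau (tau k) = k by apply: tpermK.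
(* The cycle keeps its letter [i] while [i] and [j] are exchanged elsewhere; its contribution #|X|
   is exactly the difference of [gamma i] and [gamma j]. *)
have balance k : (gamma k + (i == tau k) * #|X| = gamma (tau k) + (i == k) * #|X|)%N.
  rewrite /tau; case: tpermP => [->|->|/eqP/negPf ki /eqP/negPf kj].
  - by rewrite eqxx (negPf neq_ij); lia.
  - by rewrite eqxx (negPf neq_ij); lia.
  - by rewrite eq_sym ki.
apply/forallP/forallP => h k; have := h (tau k); have := balance k.
  by rewrite cF cf offF permM !tauK; lia.
rewrite cF cf offF permM; move: ((i == k) * _)%N ((i == tau k) * _)%N => y z.
by move: (off f _) (delta l _) => *; lia.
Qed.

End JacobiTrudi.

(** * The virtual character of a partition has norm 1 *)

Section PartitionShape.

Variables (n l : nat) (a : nat -> nat).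
Hypotheses (a_dec : forall i, (a i.+1 <= a i)%N) (al0 : a l = 0%N).
Hypothesis sum_a : (\sum_(i < l) a i = n)%N.

Let gamma (i : 'I_l) : nat := (a i + delta l i)%N.

Lemma sum_delta_perm (w : 'S_l) : (\sum_i delta l (w i) = \sum_(i < l) delta l i)%N.
Proof. by rewrite [RHS](reindex_inj (@perm_inj _ w)). Qed.

(** The inner product is a signed matrix count with column sums [gamma j - delta l (u j)]. For
    [u = 1] these are the parts of [a]; otherwise they first differ from [a] at the least point
    moved by [u], where they are larger. If one of them would be negative, every term is zero. *)
Lemma jtcf_word (u : 'S_l) : '[jtcf n gamma, wordcf n (shifted gamma u)] = (u == 1%g)%:R.
Proof.
pose B := (a 0 + l + n)%N.
rewrite /jtcf cfdot_suml.
under eq_bigr do rewrite cfdotZl (@cfdot_wordcf _ _ _ B.+1) ?ltnS ?leq_addl //.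
have [/forallP le_u|] := boolP [forall j, (delta l (u j) <= gamma j)%N]; last first.
  case/forallPn => j; rewrite -ltnNge => lt_j.
  have u1 : u != 1%g by apply: contraTneq lt_j => ->; rewrite perm1 -leqNgt leq_addl.
  rewrite (negPf u1) big1 // => w _; rewrite (_ : [set c | _] = set0) ?cards0 ?mulr0 //.
  apply/setP => c; rewrite !inE; apply/negP => /and3P[_ _ /forallP/(_ j)].
  by apply/negP; rewrite neq_ltn (leq_trans lt_j) ?leq_addl ?orbT.
pose mu (j : nat) := if insub j is Some i then (gamma i - delta l (u i))%N else 0%N.
have muE (j : 'I_l) : mu j = (gamma j - delta l (u j))%N by rewrite /mu valK.
transitivity (altcount B l mu gamma).
  apply: eq_bigr => w _; congr (_ * _%:R); apply: eq_card => c; rewrite !inE.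
  have rowsE : shifted gamma w [ffun i => (\sum_j c (i, j))%N] =
      [forall i, (\sum_j c (i, j) + delta l (w i))%N == gamma i].
    by apply: eq_forallb => i; rewrite ffunE.
  have colsE : shifted gamma u [ffun j => (\sum_i c (i, j))%N] =
      [forall j, (\sum_i c (i, j))%N == mu (nat_of_ord j)].
    apply: eq_forallb => j; rewrite ffunE muE -{1}(subnK (le_u j)).
    by rewrite eqn_add2r.
  (* The row conditions already force total [n]: summed over all rows, the shifts [delta] cancel. *)
  rewrite rowsE colsE andb_idl // => /andP[/forallP rows _]; apply/eqP.
  apply/eqP; rewrite -(eqn_add2r (\sum_i delta l (w i))); apply/eqP.
  rewrite -[in RHS]sum_a sum_delta_perm -[RHS]big_split /=.
  transitivity (\sum_i (\sum_j c (i, j) + delta l (w i)))%N.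
    rewrite big_split /= sum_delta_perm pair_big; congr addn.
    by apply: eq_bigr => -[].
  by apply: eq_bigr => i _; rewrite (eqP (rows i)).
have [u1|u1] := eqVneq u 1%g.
  apply: altcount_diag => //; first by rewrite /B; lia.
    move=> i li; have : (a i <= a l)%N by rewrite -(subnKC li); elim: (i - l)%N => [|k IHk]; rewrite ?addn0 // addnS (leq_trans _ IHk).
    by rewrite al0 leqn0 => /eqP.
  by move=> i li; rewrite -[i]/(val (Ordinal li)) muE u1 perm1 /gamma addnK.
have [t [fixed lt_t]] := perm_first_moved u1.
apply: (altcount_lex0 (t := t)) => //; first by rewrite /B; lia.
  move=> i it; have li := ltn_trans it (ltn_ord t).
  by rewrite -[i]/(val (Ordinal li)) muE fixed /gamma ?addnK.
by rewrite muE /gamma /delta; have := ltn_ord (u t); lia.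
Qed.

Lemma jtcf_norm : '[jtcf n gamma] = 1.
Proof.
rewrite {2}/jtcf cfdot_sumr (bigD1 (1%g : 'S_l)) //= big1 => [|u u1].
  by rewrite odd_perm1 scale1r jtcf_word eqxx addr0.
by rewrite cfdotZr jtcf_word (negPf u1) mulr0.
Qed.

End PartitionShape.

(** By Frobenius reciprocity the product is a sum, over words, of the signs on the stabilizer of the
    word in [H]. Each stabilizer contains a transposition, so its signs cancel. *)
Lemma cfdot_Ind_sign_word (n : nat) (T : finType) (H : {group 'S_n}) (P : pred {ffun T -> nat}) :
  (forall f : {ffun 'I_n -> T}, P (content f) ->
     exists p q, [/\ p != q, f p = f q & tperm p q \in H]) ->
  '['Ind[[set: 'S_n], H] ('Res[H] (sign_cfun n)), wordcf n P] = 0.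
Proof.
move=> transp; rewrite -Frobenius_reciprocity cfdotE.
rewrite [X in _ * X](_ : _ = 0) ?mulr0 //.
transitivity (\sum_(f : {ffun 'I_n -> T} | P (content f))
   \sum_(s in H | wfix s f) (-1) ^+ odd_perm s : algC).
  under [RHS]eq_bigr do rewrite big_mkcondr.
  rewrite exchange_big; apply: eq_bigr => s sH /=.
  rewrite !cfResE ?subsetT // wordcfE conjC_nat cfunE -sum1_card natr_sum mulr_sumr.
  rewrite big_mkcond [RHS]big_mkcond; apply: eq_bigr => f _.
  by rewrite inE mulr1; case: wfix; case: (P _).
apply: big1 => f /transp[p [q [neq_pq fpq pqH]]].
apply: eq_opp_self0; rewrite -sumrN [LHS](reindex_inj (@mulgI _ (tperm p q))) /=.
apply: eq_big => [s|s _]; last by rewrite odd_permM odd_tperm neq_pq signr_addb mulN1r.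
rewrite groupMl //; congr andb; apply/wfixP/wfixP => h t.
  have := h (tperm p q t); rewrite permM tpermK => ->.
  by case: tpermP => // ->.
by rewrite permM h; case: tpermP => [->|->|_ _]; rewrite ?fpq.
Qed.

(** Both sides say that (i, c) is a cell of the diagram of [s], read by column and by row. *)
Lemma count_ltn_sorted (s : seq nat) c i : sorted geq s ->
  (i < count (ltn c) s)%N = (c < nth 0%N s i)%N.
Proof.
elim: s i => [|x s IHs] i /=; first by rewrite nth_nil.
move=> xs; have := IHs _ (path_sorted xs); case: (ltnP c x) => [lt_cx|le_xc] IH.
  by case: i => [|i] //=; rewrite add1n ltnS IH.
have count0 : count (ltn c) s = 0%N.
  apply/eqP; rewrite -leqn0 leqNgt -has_count; apply/hasPn => y ys.
  have /allP/(_ y ys) := order_path_min (rev_trans leq_trans) xs.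
  by rewrite /= -leqNgt => /leq_trans; apply.
rewrite add0n count0 ltn0; case: i => [|i] /=; first by rewrite ltnNge le_xc.
by rewrite -IH count0.
Qed.

Lemma sum_ltn h x : (\sum_(c < h) (c < x) = minn h x)%N.
Proof.
elim: h => [|h IHh]; first by rewrite big_ord0 min0n.
by rewrite big_ord_recr /= IHh; lia.
Qed.

Lemma card_reshape_index n b c : sumn b = n ->
  (#|[pred p : 'I_n | reshape_index b p == c]| = nth 0 b c)%N.
Proof.
move=> bn.
have lt_n (o : 'I_(nth 0%N b c)) : (flatten_index b c o < n)%N.
  by rewrite -bn flatten_indexP.
rewrite -[RHS]card_ord.
rewrite -(card_imset predT (f := fun o : 'I_(nth 0%N b c) => Ordinal (lt_n o))).
  apply: eq_card => p; rewrite !inE; apply/eqP/imsetP => [pc|[o _ ->]]; last first.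
    by rewrite /= flatten_indexKl.
  have lt_o : (reshape_offset b p < nth 0 b c)%N by rewrite -pc reshape_offsetP // bn.
  by exists (Ordinal lt_o) => //; apply/val_inj; rewrite /= -[in RHS]pc reshape_indexK.
move=> o1 o2 /(congr1 val) /= /(congr1 (reshape_offset b)).
by rewrite !flatten_indexKr // => /val_inj.
Qed.

Lemma sumn_conj_partition (b : seq nat) : sorted geq b -> sumn (conj_partition b) = sumn b.
Proof.
move=> b_sorted; rewrite /conj_partition !sumnE big_map -[X in iota _ X]subn0 -/(index_iota _ _) big_mkord.
under [LHS]eq_bigr => c _ do rewrite -sum1_count big_mkcond /=.
rewrite exchange_big big_seq [RHS]big_seq; apply: eq_bigr => x xb /=.
have le_x : (x <= head 0%N b)%N.
  case: b b_sorted xb => //= y b /(order_path_min (rev_trans leq_trans))/allP yb.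
  by rewrite in_cons => /predU1P[->|/yb].
rewrite -[RHS](minn_idPr le_x) -sum_ltn; apply: eq_bigr => c _.
by case: (c < x)%N.
Qed.

Lemma nth_conj_partition b c : (c < head 0 b)%N ->
  nth 0%N (conj_partition b) c = count (ltn c) b.
Proof. by move=> lt_c; rewrite (nth_map 0%N) ?size_iota // nth_iota. Qed.

(** * Identification with the labelled irreducible character, and hooks as moves of beta-numbers *)

Section Labelling.

Variables (n : nat) (alpha : seq nat).
Hypothesis alpha_part : is_partition n alpha.

Let l := size alpha.
Let gamma (i : 'I_l) : nat := (nth 0%N alpha i + delta l i)%N.

Let alpha_sorted : sorted geq alpha. Proof. by case/and3P: alpha_part. Qed.

Let sum_alpha : sumn alpha = n. Proof. by case/and3P: alpha_part => _ _ /eqP. Qed.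

Let sum_nth_alpha : (\sum_(i < l) nth 0%N alpha i = n)%N.
Proof. by rewrite -sum_alpha sumnE (big_nth 0%N) big_mkord. Qed.

(* By pigeonhole: a word with the content of a nontrivial term of the
   determinant dominates alpha strictly, so it repeats a letter inside a row of
   the transposed diagram. *)
Lemma shifted_repetition (w : 'S_l) (f : {ffun 'I_n -> 'I_l}) :
  w != 1%g -> shifted gamma w (content f) ->
  exists p q, [/\ p != q, f p = f q & tperm p q \in young_group n (conj_partition alpha)].
Proof.
move=> w1 /forallP cf; pose b := conj_partition alpha; pose row (p : 'I_n) := reshape_index b p.
have sum_b : sumn b = n by rewrite sumn_conj_partition.
have size_b : size b = head 0%N alpha by rewrite size_map size_iota.
have [/existsP[p /existsP[q /and3P[neq_pq /eqP fpq /eqP rpq]]]|] :=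
    boolP [exists p, exists q, [&& p != q, f p == f q & row p == row q]].
  exists p, q; split=> //; rewrite inE; apply/forallP => j.
  by case: tpermP => [->|->|] //; rewrite -/(row p) -/(row q) rpq.
move/existsPn => inj; have {}inj p q : f p = f q -> row p = row q -> p = q.
  move=> fpq rpq; apply/eqP; have /existsPn/(_ q) := inj p.
  by rewrite fpq rpq !eqxx !andbT negbK.
have [t [fixed lt_t]] := perm_first_moved w1.
pose A := [pred p | (f p <= t)%N].
have cardA : (#|A| = \sum_(i < l | (i < t.+1)%N) content f i)%N.
  rewrite -sum1_card (partition_big f (fun i => (i < t.+1)%N)) //=.
  apply: eq_bigr => i it; rewrite ffunE -sum1_card; apply: eq_bigl => p.
  by rewrite !inE andb_idl // => /eqP ->; rewrite -ltnS.
(* The letters before [t] occur as often as in alpha, and [t] itself strictly more often, because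
   [w t] is larger than [t]. *)
have ltA : (\sum_(i < t.+1) nth 0%N alpha i < #|A|)%N.
  rewrite cardA (big_ord_widen l (fun i => nth 0%N alpha i) (ltn_ord t)).
  rewrite (bigD1 t) //= [ltnRHS](bigD1 t) //= -addSn leq_add //.
    have := cf t; rewrite /gamma /delta; have := ltn_ord (w t); lia.
  apply: leq_sum => i /andP[it neq_it].
  have lt_it : (i < t)%N by rewrite ltn_neqAle -ltnS it andbT (inj_eq val_inj).
  have := cf i; rewrite fixed // /gamma eqn_add2r; lia.
suff leA : (#|A| <= \sum_(i < t.+1) nth 0%N alpha i)%N by rewrite leqNgt ltA in leA.
have row_lt p : (row p < head 0%N alpha)%N by rewrite -size_b reshape_indexP // sum_b.
have -> : #|A| = (\sum_(c < head 0%N alpha) #|[pred p | A p & row p == c]|)%N.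
  rewrite -sum1_card (partition_big (fun p => Ordinal (row_lt p)) predT) //=.
  by apply: eq_bigr => c _; rewrite -sum1_card; apply: eq_bigl => p; rewrite !inE -val_eqE.
(* Without repetitions, row [c] of the transposed diagram meets [A] at most once per letter up to
   [t], and at most in its own length; the smaller number counts the [i] up to [t] with c <
   alpha_i. *)
apply: (@leq_trans (\sum_(c < head 0%N alpha) \sum_(i < t.+1) (c < nth 0%N alpha i))%N).
  apply: leq_sum => c _.
  under [leqRHS]eq_bigr => i _ do rewrite -count_ltn_sorted //.
  rewrite sum_ltn leq_min; apply/andP; split.
    rewrite -[leqRHS]card_ord.
    have f_inj : {in [pred p | A p & row p == c] &, injective (fun p => inord (f p) : 'I_t.+1)}.
      move=> p q; rewrite !inE => /andP[fp /eqP rp] /andP[fq /eqP rq] /(congr1 val).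
      by rewrite /= !inordK // => /val_inj fpq; apply: inj; rewrite // rp.
    by rewrite -(card_in_imset f_inj) max_card.
  rewrite -nth_conj_partition // -(card_reshape_index c sum_b).
  by apply: subset_leq_card; apply/subsetP => p; rewrite !inE => /andP[].
rewrite exchange_big; apply: leq_sum => i _ /=.
by rewrite sum_ltn geq_minr.
Qed.

(** The Young subgroup is the stabilizer of the word recording the row of each position, whose
    content is alpha. *)
Lemma Ind_young_word :
  'Ind[[set: 'S_n], young_group n alpha] 1 = wordcf n (shifted gamma 1%g).
Proof.
have row_lt (p : 'I_n) : (reshape_index alpha p < l)%N by rewrite reshape_indexP // sum_alpha.
pose f0 : {ffun 'I_n -> 'I_l} := [ffun p => Ordinal (row_lt p)].
have cf0 (i : 'I_l) : content f0 i = nth 0%N alpha i.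
  rewrite ffunE -(card_reshape_index i sum_alpha).
  by apply: eq_card => p; rewrite !inE ffunE -val_eqE.
have sf0 : shifted gamma 1%g (content f0) by apply/forallP => i; rewrite cf0 perm1.
apply/cfunP => s; rewrite (@Ind_stabilizer _ _ f0) => [|t].
  rewrite wordcfE; congr _%:R; apply: eq_card => f; rewrite !inE.
  by congr andb; apply/eqP/idP => [->//|sf]; apply: shifted_inj sf sf0.
by rewrite inE; apply: eq_forallb => p; rewrite !ffunE -val_eqE.
Qed.

Lemma sign_cfun_char : sign_cfun n \is a character.
Proof.
have sign_repr : mx_repr [set: 'S_n] (fun s : 'S_n => ((-1) ^+ s)%:M : 'M[algC]_1).
  by split=> [|s t _ _]; rewrite ?odd_perm1 // odd_permM signr_addb scalar_mxM.
suff -> : sign_cfun n = cfRepr (MxRepresentation sign_repr) by apply: cfRepr_char.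
by apply/cfunP => s; rewrite !cfunE inE mulr1n mxtrace_scalar.
Qed.

(** Norm 1 makes the virtual character a signed irreducible. Terms with [w] other than 1 are
    orthogonal to the induced sign character, hence do not contain ['chi_i]; the term [w = 1] does,
    so ['chi_i] is that irreducible. *)
Lemma jtcf_labeled (i : Iirr [set: 'S_n]) : labeled_by alpha i ->
  exists b : bool, jtcf n gamma = (-1) ^+ b *: 'chi_i.
Proof.
case/andP=> i_triv i_sign.
have chi_word (w : 'S_l) : w != 1%g -> '[wordcf n (shifted gamma w), 'chi_i] = 0.
  move=> w1; apply/eqP; rewrite -[_ == _]negbK -irr_consttE; apply/negP => i_w.
  suff /eqP : '['chi_i] = 0 by rewrite cfnorm_irr oner_eq0.
  apply: (constt_ortho_char _ _ i_sign i_w).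
  - by rewrite cfInd_char // cfRes_char // sign_cfun_char.
  - exact/wordcf_char/shifted_inj.
  - by apply: cfdot_Ind_sign_word => f; apply: shifted_repetition.
have a_dec j : (nth 0%N alpha j.+1 <= nth 0%N alpha j)%N.
  have [lt_j|le_j] := ltnP j.+1 (size alpha); last by rewrite nth_default.
  by move/sortedP: alpha_sorted; apply.
have jt_norm : '[jtcf n gamma] = 1.
  by apply: (jtcf_norm (a := nth 0%N alpha)); rewrite // /l nth_default.
have [b [j jtE]] := vchar_norm1P (jtcf_vchar n gamma) jt_norm.
exists b; rewrite jtE; suff -> : j = i by [].
apply/eqP; rewrite -[_ == _]negbK; apply/negP => neq_ji.
have : '[jtcf n gamma, 'chi_i] = 0.
  by rewrite jtE cfdotZl cfdot_irr (negPf neq_ji) mulr0.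
rewrite /jtcf cfdot_suml (bigD1 (1%g : 'S_l)) //= big1 => [|w w1].
  rewrite odd_perm1 scale1r addr0 -Ind_young_word => /eqP.
  by apply/negP; rewrite -irr_consttE.
by rewrite cfdotZl chi_word ?mulr0.
Qed.

(* The vanishing case of the Murnaghan-Nakayama rule: no rim hook of length x
   can be removed from alpha. *)
Lemma chi_no_hook0 (i : Iirr [set: 'S_n]) (s : 'S_n) (X : {set 'I_n}) :
  labeled_by alpha i -> X \in porbits s ->
  (forall i : 'I_l, #|X| <= gamma i -> exists j, gamma j + #|X| = gamma i)%N ->
  'chi_i s = 0.
Proof.
move=> /jtcf_labeled[b jtE] /imsetP[p0 _ ->] hook.
have := congr1 (fun phi : 'CF(_) => phi s) jtE; rewrite (jtcf_cycle0 hook) cfunE.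
by move/esym/eqP; rewrite mulf_eq0 signr_eq0 => /eqP.
Qed.

End Labelling.

(* Cells (i, c) of the diagram have hook length
   alpha_i - c + #{j : c < alpha_j} - i - 1. *)
Lemma beta_set_hook (alpha : seq nat) (x : nat) : (0 < x)%N -> sorted geq alpha ->
  (forall i c, (c < nth 0 alpha i)%N ->
     (nth 0 alpha i + count (ltn c) alpha != x + c + i.+1)%N) ->
  forall i : 'I_(size alpha), (x <= nth 0 alpha i + delta (size alpha) i)%N ->
  exists j : 'I_(size alpha),
    (nth 0 alpha j + delta (size alpha) j + x = nth 0 alpha i + delta (size alpha) i)%N.
Proof.
set l := size alpha; set a := nth 0%N alpha => x_gt0 alpha_sorted no_hook i le_x.
pose g (j : nat) := (a j + delta l j)%N; pose y := (g i - x)%N.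
have {}le_x : (x <= g i)%N := le_x.
case: (pickP (fun j : 'I_l => g j == y)) => [j /eqP gj|no_j].
  by exists j; rewrite -/(g j) gj subnK.
have a_anti j1 j2 : (j1 <= j2)%N -> (a j2 <= a j1)%N.
  move=> le_j; have [lt_j2|le_j2] := ltnP j2 l; last by rewrite /a nth_default.
  have geq_refl : reflexive geq by exact: leqnn.
  by apply: (sorted_leq_nth (rev_trans leq_trans) geq_refl 0%N alpha_sorted); rewrite ?inE // (leq_ltn_trans le_j).
have g_anti j1 j2 : (j1 <= j2)%N -> (g j2 <= g j1)%N.
  by move=> le_j; rewrite leq_add ?a_anti // /delta leq_sub2l.
(* Here [t] becomes the number of beta-numbers above [y]. *)
have ex_t : exists t, (t == l) || (g t <= y)%N by exists l; rewrite eqxx.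
case: (ex_minnP ex_t) => t t_stop t_min.
have le_tl : (t <= l)%N by apply: t_min; rewrite eqxx.
have lt_it : (i < t)%N.
  rewrite ltnNge; apply/negP => le_ti; case/orP: t_stop => [/eqP tl|le_gt].
    by move: le_ti; rewrite tl leqNgt ltn_ord.
  by have := leq_trans (g_anti _ _ le_ti) le_gt; rewrite /y; move: (g i) le_x => z; lia.
have gt_y : (y < g t.-1)%N.
  by rewrite ltnNge; apply/negP => le_y; have := t_min t.-1; rewrite le_y orbT; lia.
have stop : t = l \/ (t < l)%N /\ (g t < y)%N.
  case/orP: t_stop => [/eqP|le_y]; first by left.
  have [lt_tl|] := ltnP t l; last by left; apply/eqP; rewrite eqn_leq le_tl.
  right; split=> //; rewrite ltn_neqAle le_y andbT.
  by have /= -> := no_j (Ordinal lt_tl).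
(* The gap value [y] between consecutive beta-numbers stands for the column [c] of length [t], with
   y = c + l - t. The cell (i, c) then has hook length [g i - y], which is [x]. *)
pose c := (y - (l - t))%N.
have le_ly : (l - t <= y)%N by case: stop => [->|[]]; rewrite ?subnn // /g /delta; lia.
have c1 : (c < a t.-1)%N by move: gt_y; rewrite /g /delta /c; lia.
have c2 : (a t <= c)%N.
  by case: stop => [->|[]]; rewrite ?[a l]nth_default // /g /delta /c; lia.
have ct : count (ltn c) alpha = t.
  apply/eqP; rewrite eqn_leq leqNgt count_ltn_sorted // -leqNgt c2 /=.
  by move: c1; rewrite -count_ltn_sorted //; lia.
have c_ai : (c < a i)%N by apply: leq_trans c1 (a_anti _ _ _); lia.
have /eqP[] := no_hook i c c_ai; rewrite ct -/a.
move: le_ly (ltn_ord i) le_x; rewrite /c /y /g /delta -/l; lia.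
Qed.

(** * Hook lengths of a self-conjugate partition, block by block *)

Section Blocks.

Variables (m : nat) (r k : nat -> nat).
Hypothesis hr_decr : forall j : nat, (1 <= j < m)%N -> (r j.+1 < r j)%N.

Let alpha := exp_partition m r k.
Let K q : nat := (\sum_(1 <= t < q.+1) k t)%N.

Hypothesis alpha_sorted : sorted geq alpha.
Hypothesis hself : conj_partition alpha = alpha.

Lemma part_anti i j : (1 <= i)%N -> (i <= j)%N -> (j <= m)%N -> (r j <= r i)%N.
Proof.
move=> i_gt0 le_ij; rewrite -(subnKC le_ij); elim: (j - i)%N => [|d IHd]; first by rewrite addn0.
rewrite addnS => lt_m; apply: leq_trans (IHd (ltnW lt_m)).
by apply/ltnW/hr_decr; lia.
Qed.

Lemma multsumS q : K q.+1 = (K q + k q.+1)%N.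
Proof. by rewrite /K big_nat_recr. Qed.

Lemma multsum_mono i j : (i <= j)%N -> (K i <= K j)%N.
Proof.
move=> le_ij; rewrite -(subnKC le_ij); elim: (j - i)%N => [|d IHd]; first by rewrite addn0.
by rewrite addnS multsumS (leq_trans IHd) ?leq_addr.
Qed.

Lemma multsum_block i j : (i < K j)%N -> exists p, [/\ (1 <= p)%N, (p <= j)%N, (K p.-1 <= i)%N & (i < K p)%N].
Proof.
elim: j => [|j IHj]; first by rewrite /K big_geq.
have [/IHj[p [p1 p2 p3 p4]] _|le_i lt_i] := ltnP i (K j).
  by exists p; split; rewrite ?(leq_trans p2).
by exists j.+1.
Qed.

Lemma count_exp_partition c q : (q <= m)%N ->
  (forall t, (1 <= t <= m)%N -> (c < r t)%N = (t <= q)%N) -> count (ltn c) alpha = K q.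
Proof.
move=> le_qm rc; rewrite /alpha /exp_partition count_flatten -map_comp sumnE big_map.
rewrite -[X in iota 1 X](subn1 m.+1) -/(index_iota 1 m.+1).
rewrite (big_cat_nat (n := q.+1)) //= [X in (_ + X)%N]big1_seq ?addn0.
  rewrite /K !big_nat; apply: eq_bigr => t t_le; rewrite count_nseq /= rc; last by lia.
  by rewrite (_ : t <= q)%N ?mul1n //; lia.
move=> t; rewrite mem_index_iota => t_gt; rewrite count_nseq /= rc; last by lia.
by rewrite leqNgt (_ : q < t)%N //; lia.
Qed.

Lemma threshold c : exists2 q, (q <= m)%N &
  forall t, (1 <= t <= m)%N -> (c < r t)%N = (t <= q)%N.
Proof.
suff H j : (j <= m)%N -> exists2 q, (q <= j)%N &
    forall t, (1 <= t <= j)%N -> (c < r t)%N = (t <= q)%N by apply: H.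
elim: j => [|j IHj] le_jm; first by exists 0%N => // t; lia.
have [lt_c|le_c] := ltnP c (r j.+1).
  exists j.+1 => // t /andP[t_gt0 t_le]; rewrite t_le.
  by rewrite (leq_trans lt_c) // part_anti.
have [q le_qj qE] := IHj (ltnW le_jm); exists q; first exact: leqW.
move=> t /andP[t_gt0]; rewrite leq_eqVlt => /predU1P[->|t_le]; last first.
  by apply: qE; rewrite t_gt0.
by rewrite ltnNge le_c /= leqNgt ltnS le_qj.
Qed.

(** A number is determined by the [c] below it, and the parts exceeding [c] fill whole blocks, so
    comparing [i] with the block ends decides each [c]. *)
Lemma nth_exp_partition i p : (1 <= p <= m)%N -> (K p.-1 <= i)%N -> (i < K p)%N ->
  nth 0%N alpha i = r p.
Proof.
move=> /andP[p_gt0 le_pm] le_i lt_i.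
suff E c : (c < nth 0%N alpha i)%N = (c < r p)%N.
  have [lt_p|lt_p|//] := ltngtP (nth 0%N alpha i) (r p); first by rewrite -E ltnn in lt_p.
  by rewrite E ltnn in lt_p.
have [q le_qm qE] := threshold c.
rewrite -count_ltn_sorted // (count_exp_partition le_qm qE) qE ?p_gt0 //.
apply/idP/idP => [lt_iq|le_pq]; last by apply: leq_trans lt_i (multsum_mono _).
rewrite leqNgt; apply/negP => lt_qp.
have : (K q <= K p.-1)%N by apply: multsum_mono; lia.
by lia.
Qed.

Lemma size_exp_partition : size alpha = K m.
Proof.
rewrite /alpha /exp_partition size_flatten /shape -map_comp sumnE big_map.
rewrite -[X in iota 1 X](subn1 m.+1) -/(index_iota 1 m.+1).
by apply: eq_bigr => t _ /=; rewrite size_nseq.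
Qed.

(** Column lengths become row lengths, so rows and columns share the same blocks. Beyond the diagram
    both sides are 0. *)
Lemma count_self_conj c : count (ltn c) alpha = nth 0%N alpha c.
Proof.
have [lt_c|le_c] := ltnP c (head 0%N alpha); first by rewrite -[in RHS]hself nth_conj_partition.
rewrite nth_default; last by rewrite -hself size_map size_iota.
by apply/eqP; rewrite -leqn0 leqNgt count_ltn_sorted // nth0 -leqNgt.
Qed.

(* For a self-conjugate partition the hook lengths in the block of rows p and
   columns m + 1 - q lie strictly between r_p + r_q - K_p - K_q and
   r_p + r_q - K_(p-1) - K_(q-1), where K_q = k_1 + ... + k_q; both bounds
   decrease in p and q, so the blocks with p + q = s and p + q = s - 1 suffice. *)
Lemma no_hook_exp_partition (x s : nat) : (3 <= s <= m.+1)%N ->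
  (forall p q, (1 <= p)%N -> (1 <= q)%N -> (p + q = s)%N ->
     (r p + r q <= x + K p.-1 + K q.-1)%N) ->
  (forall p q, (1 <= p)%N -> (1 <= q)%N -> (p + q = s.-1)%N ->
     (x + K p + K q <= r p + r q)%N) ->
  forall i c, (c < nth 0 alpha i)%N ->
     (nth 0 alpha i + count (ltn c) alpha != x + c + i.+1)%N.
Proof.
move=> s_le upper lower i c lt_c.
have lt_i : (i < K m)%N.
  by rewrite -size_exp_partition ltnNge; apply: contraTN lt_c => /(nth_default 0%N) ->.
have lt_cm : (c < K m)%N.
  rewrite -size_exp_partition ltnNge; apply/negP => le_c.
  have := nth_default 0%N le_c; rewrite -count_self_conj => count0.
  have := count_ltn_sorted c i alpha_sorted; rewrite count0 lt_c; lia.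
have [p [p1 p2 p3 p4]] := multsum_block lt_i; have [q [q1 q2 q3 q4]] := multsum_block lt_cm.
rewrite count_self_conj (@nth_exp_partition i p) ?p1 // (@nth_exp_partition c q) ?q1 //.
apply/eqP => hook; have [le_s|lt_s] := leqP s (p + q)%N.
  (* Shrink (p, q) to a pair on the antidiagonal p0 + q0 = s with both entries positive; the hook is
     then shorter than [x]. *)
  pose p0 := minn p s.-1; pose q0 := (s - p0)%N.
  have := upper p0 q0; have := @part_anti p0 p; have := @part_anti q0 q.
  have := @multsum_mono p0.-1 p.-1; have := @multsum_mono q0.-1 q.-1.
  by rewrite /q0 /p0; lia.
(* Enlarge [q] until p + q0 = s - 1, still within 1..m; the hook is then longer than [x]. *)
pose q0 := (s.-1 - p)%N.
have := lower p q0; have := @part_anti q q0; have := @multsum_mono q q0.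
by rewrite /q0; lia.
Qed.

End Blocks.

(** * From the interval conditions to the antidiagonal bounds *)

Lemma le_max_lt (f : nat -> int) l i : (i < l)%N -> f i <= max_lt l f.
Proof. by move=> il; apply: le_bigmax_seq => //; rewrite mem_index_iota. Qed.

Lemma min_lt_le (f : nat -> int) l i : (i < l)%N -> min_lt l f <= f i.
Proof. by move=> il; apply: ge_bigmin_seq => //; rewrite mem_index_iota. Qed.

(** For indices within 1..m none of the boundary conventions applies; all the pairs taken from the
    two antidiagonals are of this kind. *)
Lemma rk_exprE n m r k i j p q : (0 < i <= m)%N -> (0 < j <= m)%N -> (p <= m)%N -> (q <= m)%N ->
  rk_expr n m r k i j p q =
  (r i + r j)%N%:Z - (\sum_(1 <= t < p.+1) k t + \sum_(1 <= t < q.+1) k t)%N%:Z.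
Proof.
move=> /andP[i0 im] /andP[j0 jm] pm qm; rewrite /rk_expr im jm !ltnNge pm qm /=.
rewrite !orbF !gtn_eqF //= PoszD [in RHS]PoszD !(big_morph Posz PoszD (erefl 0%:Z)).
by rewrite opprD addrA.
Qed.

Theorem theorem5p4 (n m : nat) (r k : nat -> nat) (beta : seq nat) (x : nat)
    (i : Iirr [set: 'S_n]) (s : 'S_n)
    (hr_decr : forall j : nat, (1 <= j < m)%N -> (r j.+1 < r j)%N)
    (hr_pos : forall j : nat, (1 <= j <= m)%N -> (0 < r j)%N)
    (hk_pos : forall j : nat, (1 <= j <= m)%N -> (0 < k j)%N)
    (halpha : is_partition n (exp_partition m r k))
    (hself : conj_partition (exp_partition m r k) = exp_partition m r k)
    (hbeta : is_partition n beta)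
    (hx : x \in beta)
    (hinterval :
      (exists v : nat, (2 <= v <= m %/ 2 + 1)%N /\
         Order.max (aN n m r k v) (cN n m r k v) <= x%:Z
           <= Order.min (bN n m r k v) (dN n m r k v))
      \/
      (exists v : nat, (2 <= v <= (m + 1) %/ 2)%N /\
         Order.max (aE n m r k v) (cE n m r k v) <= x%:Z
           <= Order.min (bE n m r k v) (dE n m r k v)))
    (hi : labeled_by (exp_partition m r k) i)
    (hs : has_cycle_type s beta) :
  'chi_i s = 0.
Proof.
have x_gt0 : (0 < x)%N by case/and3P: hbeta => _ /allP/(_ x hx).
have alpha_sorted : sorted geq (exp_partition m r k) by case/and3P: halpha.
have /mapP[X Xs xX] : x \in [seq #|X| | X : {set 'I_n} in porbits s].
  by rewrite (perm_mem hs).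
rewrite mem_enum in Xs; apply: (chi_no_hook0 halpha hi Xs); rewrite -xX.
apply: beta_set_hook => //.
pose K q : nat := (\sum_(1 <= t < q.+1) k t)%N.
suff [c [c_le upper lower]] : exists c, [/\ (3 <= c <= m.+1)%N,
    forall p q, (1 <= p <= q)%N -> (p + q = c)%N -> (r p + r q <= x + K p.-1 + K q.-1)%N &
    forall p q, (1 <= p <= q)%N -> (p + q = c.-1)%N -> (x + K p + K q <= r p + r q)%N].
  (* The bounds are symmetric in p and q, while the index i of the extrema only reaches pairs with p
     at most q. *)
  apply: (no_hook_exp_partition hr_decr alpha_sorted hself c_le) => p q p_gt0 q_gt0 pq.
    have [le_pq|/ltnW le_qp] := leqP p q; first by apply: upper; rewrite ?p_gt0.
    by rewrite [leqLHS]addnC [leqRHS]addnAC; apply: upper; rewrite ?q_gt0 // addnC.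
  have [le_pq|/ltnW le_qp] := leqP p q; first by apply: lower; rewrite ?p_gt0.
  by rewrite addnAC [leqRHS]addnC; apply: lower; rewrite ?q_gt0 // addnC.
case: hinterval => -[v [v_le /andP[]]]; rewrite ge_max le_min.
  (* In the N case [cN] bounds the antidiagonal p + q = 2v - 1 and [bN] the one with p + q = 2v - 2,
     both at index i = v - 1 - p. *)
  case/andP=> _ c_lo /andP[b_hi _]; exists (2 * v).-1; split; first by lia.
    move=> p q /andP[p_gt0 le_pq] pq.
    have lt_i : (v - p.+1 < v - 1)%N by lia.
    have := le_trans (le_max_lt _ lt_i) c_lo.
    rewrite rk_exprE; try lia.
    have -> : (v - (v - p.+1) - 1 = p)%N by lia.
    have -> : (v - (v - p.+1) - 2 = p.-1)%N by lia.
    have -> : (v + (v - p.+1) - 1 = q.-1)%N by lia.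
    have -> : (v + (v - p.+1) = q)%N by lia.
    by rewrite -/(K p.-1) -/(K q.-1); lia.
  move=> p q /andP[p_gt0 le_pq] pq.
  have lt_i : (v - p.+1 < v - 1)%N by lia.
  have := le_trans b_hi (min_lt_le _ lt_i).
  rewrite rk_exprE; try lia.
  have -> : (v - (v - p.+1) - 1 = p)%N by lia.
  have -> : (v + (v - p.+1) - 1 = q)%N by lia.
  by rewrite -/(K p) -/(K q); lia.
(* In the E case [aE] bounds p + q = 2v at index i = v - p, and [dE] bounds p + q = 2v - 1 at i = v
   - 1 - p. *)
case/andP=> a_lo _ /andP[_ d_hi]; exists (2 * v)%N; split; first by lia.
  move=> p q /andP[p_gt0 le_pq] pq.
  have lt_i : (v - p < v)%N by lia.
  have := le_trans (le_max_lt _ lt_i) a_lo.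
  rewrite rk_exprE; try lia.
  have -> : (v - (v - p) - 1 = p.-1)%N by lia.
  have -> : (v + (v - p) - 1 = q.-1)%N by lia.
  have -> : (v - (v - p) = p)%N by lia.
  have -> : (v + (v - p) = q)%N by lia.
  by rewrite -/(K p.-1) -/(K q.-1); lia.
move=> p q /andP[p_gt0 le_pq] pq.
have lt_i : (v - p.+1 < v)%N by lia.
have := le_trans d_hi (min_lt_le _ lt_i).
rewrite rk_exprE; try lia.
have -> : (v - (v - p.+1) - 1 = p)%N by lia.
have -> : (v + (v - p.+1) = q)%N by lia.
by rewrite -/(K p) -/(K q); lia.
Qed.
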